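(* Let $\mathcal{H}_1,\mathcal{H}_2$ be real Hilbert spaces, let $A:\mathcal{H}_1\to 2^{\mathcal{H}_1}$ and $B:\mathcal{H}_2\to 2^{\mathcal{H}_2}$ be maximally monotone, and let $C:\mathcal{H}_1\to\mathcal{H}_2$ be a non-zero bounded linear operator with adjoint $C^*$. Let $\psi_1:\mathcal{H}_1\to\mathbb{R}$ and $\psi_2:\mathcal{H}_2\to\mathbb{R}$ be continuously Fréchet differentiable convex functions with Bregman divergences $$D_1(x,\bar{x})=\psi_1(x)-\psi_1(\bar{x})-\langle\nabla\psi_1(\bar{x}),x-\bar{x}\rangle,\qquad D_2(y,\bar{y})=\psi_2(y)-\psi_2(\bar{y})-\langle\nabla\psi_2(\bar{y}),y-\bar{y}\rangle,$$ and assume that there exists $\alpha>0$ such that $$D_1(x,\bar{x})+D_2(y,\bar{y})-\langle C(x-\bar{x}),y-\bar{y}\rangle\ge\alpha\left(\|x-\bar{x}\|^2+\|y-\bar{y}\|^2\right)\qquad\text{for all }x,\bar{x}\in\mathcal{H}_1,\ y,\bar{y}\in\mathcal{H}_2 .$$ Assume that the pair of primal-dual monotone inclusions $$\text{(P)}\quad\text{find }x\in\mathcal{H}_1\text{ s.t. }0\in Ax+C^*(B(Cx)),$$ $$\text{(D)}\quad\text{find }y\in\mathcal{H}_2\text{ s.t. }y\in B(Cx),\ -C^*y\in Ax\text{ for some }x\in\mathcal{H}_1,$$ admits a solution $(x^*,y^* )\in\mathcal{H}_1\times\mathcal{H}_2$. Let $(x^n,\tilde{x}^n,y^n)_{n\ge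 0}$ be generated, from arbitrary initial points $(x^0,\tilde{x}^0,y^0)\in\mathcal{H}_1\times\mathcal{H}_1\times\mathcal{H}_2$, by $$\begin{cases}x^{n+1}=(\nabla_x D_1(\cdot,x^n)+A)^{-1}(-C^*y^n),\\ \tilde{x}^{n+1}=2x^{n+1}-x^n,\\ y^{n+1}=(\nabla_y D_2(\cdot,y^n)+B^{-1})^{-1}(C\tilde{x}^{n+1}),\end{cases}\qquad n\ge 0 .$$ For $N\ge 1$ let $$X^N=\frac1N\sum_{n=1}^N x^n,\qquad Y^N=\frac1N\sum_{n=1}^N y^n .$$ Then the sequence $\{(X^N,Y^N)\}_{N\ge1}$ is bounded in $\mathcal{H}_1\times\mathcal{H}_2$, and every weak (subsequential) limit $(X,Y)$ of it is a solution of the pair (P)–(D).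
   Context: A pair $(x,y)\in\mathcal{H}_1\times\mathcal{H}_2$ is called a solution of the pair (P)–(D) if $-C^*y\in Ax$ and $y\in B(Cx)$ (equivalently $Cx\in B^{-1}y$). The inverse of a set-valued map $M$ is defined by $x\in M^{-1}z\iff z\in Mx$. The gradients $\nabla_x D_1(\cdot,\bar{x})$ and $\nabla_y D_2(\cdot,\bar{y})$ are taken in the first argument, so $\nabla_x D_1(x,\bar{x})=\nabla\psi_1(x)-\nabla\psi_1(\bar{x})$ and $\nabla_y D_2(y,\bar{y})=\nabla\psi_2(y)-\nabla\psi_2(\bar{y})$. Thus the iteration means $$-C^*y^n\in\nabla\psi_1(x^{n+1})-\nabla\psi_1(x^n)+Ax^{n+1},\qquad C\tilde{x}^{n+1}\in\nabla\psi_2(y^{n+1})-\nabla\psi_2(y^n)+B^{-1}y^{n+1}.$$ A set-valued map $M$ is monotone if $\langle x-x',u-u'\rangle\ge 0$ whenever $u\in Mx$, $u'\in Mx'$, and maximally monotone if moreover its graph is not properly contained in the graph of another monotone map. A weak subsequential limit of a sequence is the weak limit of some weakly convergent subsequence. *)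

(* Defs.v *)
From HB Require Import structures.
From mathcomp Require Import all_boot all_order all_algebra.
From mathcomp Require Import all_classical all_reals all_analysis.
From mathcomp Require Import ring lra.

Set Implicit Arguments.
Unset Strict Implicit.
Unset Printing Implicit Defensive.

Import Order.TTheory GRing.Theory Num.Theory.
Import numFieldNormedType.Exports.

Local Open Scope classical_set_scope.
Local Open Scope ring_scope.

(* A real Hilbert space: a complete normed space whose norm is induced by a
   symmetric bilinear form. *)
HB.mixin Record isHilbert (R : realType) H of CompleteNormedModule R H := {
  inner : H -> H -> R;
  innerC : forall x y, inner x y = inner y x;
  innerDl : forall x y z, inner (x + y) z = inner x z + inner y z;
  innerZl : forall (a : R) x z, inner (a *: x) z = a * inner x z;
  inner_norm : forall x : H, inner x x = `|x| ^+ 2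
}.

#[short(type="hilbertType")]
HB.structure Definition Hilbert (R : realType) :=
  {H of isHilbert R H & CompleteNormedModule R H}.

Section HilbertOps.
Context {R : realType}.

(* Meaningful for bounded linear C, see adjointP. *)
Definition adjoint {H1 H2 : hilbertType R} (C : H1 -> H2) (y : H2) : H1 :=
  xget 0 [set z | forall x, inner (C x) y = inner x z].

(* The Riesz representative of the Frechet derivative, see gradientP. *)
Definition gradient {H : hilbertType R} (psi : H -> R^o) (x : H) : H :=
  xget 0 [set g | forall h, 'd psi x h = inner g h].

(* By the Riesz isometry, continuity of the gradient is continuity of the
   derivative in operator norm. *)
Definition cont_frechet_diff {H : hilbertType R} (psi : H -> R^o) :=
  (forall x, differentiable psi x) /\ continuous (gradient psi).

Definition bregman {H : hilbertType R} (psi : H -> R^o) (x xb : H) : R^o :=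
  psi x - psi xb - inner (gradient psi xb) (x - xb).

Definition monotone_op {H : hilbertType R} (M : H -> set H) :=
  forall x x' u u', M x u -> M x' u' -> 0 <= inner (x - x') (u - u').

Definition graph_op {H : hilbertType R} (M : H -> set H) : set (H * H) :=
  [set xu | M xu.1 xu.2].

Definition maximally_monotone {H : hilbertType R} (M : H -> set H) :=
  monotone_op M /\
  ~ exists2 M' : H -> set H, monotone_op M' & graph_op M `<` graph_op M'.

Definition inv_op {S T : Type} (M : S -> set T) : T -> set S :=
  fun z => [set x | M x z].

Definition add_op {H : hilbertType R} (f : H -> H) (M : H -> set H) :
    H -> set H :=
  fun x => [set f x + u | u in M x].

Definition pd_solution {H1 H2 : hilbertType R} (A : H1 -> set H1)
    (B : H2 -> set H2) (C : H1 -> H2) (x : H1) (y : H2) :=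
  A x (- adjoint C y) /\ B (C x) y.

(* The resolvents below are a priori multivalued, hence membership instead
   of equality. *)
Definition pdhg_iterates {H1 H2 : hilbertType R} (A : H1 -> set H1)
    (B : H2 -> set H2) (C : H1 -> H2) (psi1 : H1 -> R^o) (psi2 : H2 -> R^o)
    (x xt : nat -> H1) (y : nat -> H2) :=
  forall n,
    [/\ inv_op (add_op (gradient (bregman psi1 ^~ (x n))) A)
          (- adjoint C (y n)) (x n.+1),
        xt n.+1 = 2 *: x n.+1 - x n &
        inv_op (add_op (gradient (bregman psi2 ^~ (y n))) (inv_op B))
          (C (xt n.+1)) (y n.+1)].

Definition ergodic_avg {V : normedModType R} (x : nat -> V) (N : nat) : V :=
  N%:R^-1 *: \sum_(1 <= n < N.+1) x n.

(* Weak convergence is tested on the topological dual. The norm of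
   H1 * H2 is the max norm; it is equivalent to the Hilbert product norm, so
   it yields the same bounded sequences and the same weak convergence. *)
Definition weak_cvg {V : normedModType R} (u : nat -> V) (l : V) :=
  forall f : {linear V -> R^o}, continuous f -> f (u n) @[n --> \oo] --> f l.

Definition weak_subseq_limit {V : normedModType R} (u : nat -> V) (l : V) :=
  exists2 phi : nat -> nat, increasing_seq phi & weak_cvg (u \o phi) l.

End HilbertOps.

Section Riesz.
Context {R : realType} {H : hilbertType R}.
Implicit Types x y z : H.

Lemma innerDr x y z : inner x (y + z) = inner x y + inner x z.
Proof. by rewrite innerC innerDl !(innerC _ x). Qed.

Lemma innerZr (a : R) x y : inner x (a *: y) = a * inner x y.
Proof. by rewrite innerC innerZl innerC. Qed.

Lemma inner_inj x y : (forall h, inner x h = inner y h) -> x = y.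
Proof.
move=> xy; apply/eqP; rewrite -subr_eq0 -normr_eq0 -sqrf_eq0 -inner_norm.
by rewrite innerDl -scaleN1r innerZl xy mulN1r subrr.
Qed.

Lemma inner_le x y : `|inner x y| <= `|x| * `|y|.
Proof.
have [->|y0] := eqVneq y 0.
  by rewrite -(scale0r 0) innerZr mul0r normr0 mulr_ge0.
have y2 : 0 < `|y| ^+ 2 by rewrite exprn_gt0// normr_gt0.
have := sqr_ge0 `|x - (inner x y / `|y| ^+ 2) *: y|.
rewrite -inner_norm -scaleNr !(innerDl, innerDr, innerZl, innerZr).
rewrite !inner_norm (innerC y x) => h.
rewrite -(@ler_pXn2r _ 2) ?nnegrE ?mulr_ge0// exprMn real_normK ?num_real//.
rewrite -ler_pdivrMr//; move: h; set a := inner x y; set c := `|y| ^+ 2 in y2 *.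
have -> : `|x| ^+ 2 + - (a / c) * a + (- (a / c) * a + - (a / c) * (- (a / c) * c))
  = `|x| ^+ 2 - a ^+ 2 / c by field; rewrite gt_eqF.
by rewrite subr_ge0.
Qed.

Lemma riesz (f : {linear H -> R^o}) :
  continuous f -> exists z, forall h, f h = inner z h.
Proof.
move=> /(_ 0)/(@continuous_linear_bounded _ _ _ 0)/linear_boundedP[M0 [_ fM0]].
pose M : R := Num.max M0 0 + 1.
have fM x : `|f x| <= M * `|x|.
  by apply: fM0; rewrite /M ltr_pwDr// le_max lexx.
pose J x : R := `|x| ^+ 2 / 2 - f x.
have JE a b : J (2^-1 *: (a + b)) = (J a + J b) / 2 - `|a - b| ^+ 2 / 8.
  rewrite /J linearZ linearD -!inner_norm -[- b]scaleN1r.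
  rewrite !(innerDl, innerDr, innerZl, innerZr) (innerC b a) /=.
  by rewrite /GRing.scale /=; field.
have Jlb : forall x, - (M ^+ 2 / 2) <= J x.
  move=> x.
  have := fM x; rewrite ler_norml => /andP[_ fx]; rewrite /J.
  have := sqr_ge0 (`|x| - M); lra.
have Jinf : has_inf (range J).
  split; first by exists (J 0), 0.
  by exists (- (M ^+ 2 / 2)); apply/lbP => _ [w _ <-].
pose m := inf (range J).
have mJ : forall x, m <= J x by move=> x; apply: (inf_lbound Jinf.2); exists x.
have /choice[u uP] n : exists x, J x < m + n.+1%:R^-1.
  have [|_ [x _ <-] ?] := inf_adherent (eps := n.+1%:R^-1) _ Jinf.
    by rewrite invr_gt0.
  by exists x.
have dist : forall a b, `|a - b| ^+ 2 <= 4 * (J a + J b - 2 * m).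
  by move=> a b; have := mJ (2^-1 *: (a + b)); rewrite JE; lra.
have ucvg : cvgn u.
  apply: cauchy_cvg; apply/cauchyP => _/posnumP[e].
  have [N _ NP] : \forall n \near \oo, n.+1%:R^-1 < e%:num ^+ 2 / 8 :> R.
    have e0 : 0 < e%:num ^+ 2 / 8 :> R by rewrite divr_gt0// exprn_gt0.
    have /cvgrPdist_lt/(_ _ e0) := @cvg_harmonic R.
    apply: filterS => n /=; rewrite sub0r normrN ger0_norm//.
  exists (u N); exists N => // n /= Nn.
  rewrite -ball_normE /=; rewrite -(@ltr_pXn2r _ 2)// ?nnegrE//.
  apply: (le_lt_trans (dist _ _)).
  have /= := NP n Nn; have /= := NP N (leqnn N); move: (uP n) (uP N).
  move: (n.+1%:R^-1) (N.+1%:R^-1) (J (u n)) (J (u N)) (e%:num ^+ 2).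
  by move=> *; lra.
pose z := limn u; have uz : u n @[n --> \oo] --> z by [].
have fcont : continuous f.
  by apply: bounded_linear_continuous; apply/linear_boundedP; exists M0; split=> //; rewrite num_real.
have Jz : J z <= m.
  have Ju : J (u n) @[n --> \oo] --> J z.
    apply: cvgB; last exact: (continuous_cvg _ (fcont z) uz).
    apply: cvgMl; rewrite expr2; under eq_fun do rewrite expr2.
    by apply: cvgM; apply: cvg_norm.
  have mh : m + n.+1%:R^-1 @[n --> \oo] --> m.
    by rewrite -[X in _ --> X]addr0; apply: cvgD; [exact: cvg_cst|exact: cvg_harmonic].
  apply: (ler_cvg_to Ju mh); near=> n; exact/ltW/uP.
exists z => h; apply/eqP; rewrite eq_sym -subr_eq0; apply/eqP.
set d := inner z h - f h.
have q : forall t : R, 0 <= t * d + t ^+ 2 * `|h| ^+ 2 / 2.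
  move=> t.
  have := le_trans Jz (mJ (z + t *: h)); rewrite /J linearD linearZ -!inner_norm.
  rewrite !(innerDl, innerDr, innerZl, innerZr) (innerC h z) /d.
  rewrite !inner_norm [X in _ - (f z + X)](_ : _ = t * f h)//; move: (f z) (f h : R) (inner z h) (`|z|) (`|h|) => p p1 p2 p3 p4; lra.
have c0 : 0 < `|h| ^+ 2 + 1 by rewrite ltr_wpDl// sqr_ge0.
have := q (- d / (`|h| ^+ 2 + 1)).
have -> : - d / (`|h| ^+ 2 + 1) * d + (- d / (`|h| ^+ 2 + 1)) ^+ 2 * `|h| ^+ 2 / 2
   = - (d ^+ 2 * ((`|h| ^+ 2 / 2 + 1) / (`|h| ^+ 2 + 1) ^+ 2)).
  by field; rewrite gt_eqF.
rewrite oppr_ge0 pmulr_lle0; last first.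
  by rewrite divr_gt0 ?exprn_gt0// ltr_wpDl// divr_ge0// sqr_ge0.
by move=> d0; apply/eqP; rewrite -sqrf_eq0 eq_le d0 sqr_ge0.
Unshelve. all: by end_near. Qed.

End Riesz.

Section AdjointGradient.
Context {R : realType} {H1 H2 : hilbertType R}.

Lemma gradientP (psi : H1 -> R^o) x :
  differentiable psi x -> forall h, 'd psi x h = inner (gradient psi x) h.
Proof.
move=> dpsi; have [z zP] := riesz (diff_continuous dpsi).
have ex : [set g | forall h, 'd psi x h = inner g h] !=set0 by exists z.
by rewrite /gradient; case: xgetP => [g _ //|no]; case: ex => g /no.
Qed.

Lemma adjointP (C : {linear H1 -> H2}) :
  continuous C -> forall x y, inner (C x) y = inner x (adjoint C y).
Proof.
move=> cC x y; rewrite /adjoint.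
have lin : linear (fun x => inner (C x) y : R^o).
  by move=> a u v; rewrite linearP innerDl innerZl.
pose f : {linear H1 -> R^o} := HB.pack (fun x => inner (C x) y : R^o) (GRing.isLinear.Build _ _ _ _ _ lin).
have [M [Mr CM]] := (linear_boundedP C).1 ((linear_bounded_continuous C).2 cC).
have fc : continuous f.
  apply/linear_bounded_continuous/linear_boundedP; exists (M * `|y|).
  split=> [|r Mr' z]; first by rewrite num_real.
  pose e := (r - M * `|y|) / (`|y| + 1).
  have y1 : 0 < `|y| + 1 by rewrite ltr_wpDl.
  have e0 : 0 < e by rewrite divr_gt0// subr_gt0.
  have Cz : `|C z| <= (M + e) * `|z| by apply: CM; rewrite ltrDl.
  apply: (le_trans (inner_le _ _)).
  apply: (le_trans (ler_wpM2r (normr_ge0 y) Cz)).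
  rewrite mulrAC ler_wpM2r// mulrDl -lerBrDl /e mulrAC ler_pdivrMr//.
  by apply: ler_wpM2l; rewrite ?lerDl// subr_ge0 ltW.
have [z zP] := riesz fc.
case: xgetP => [g _ gP|/(_ z)[w]]; first exact: gP.
by rewrite (innerC w z) -zP.
Qed.

Lemma gradient_bregman (psi : H1 -> R^o) xb x :
  differentiable psi x ->
  gradient (bregman psi ^~ xb) x = gradient psi x - gradient psi xb.
Proof.
move=> dpsi; set g := gradient psi xb.
have lin : linear (inner g : H1 -> R^o).
  by move=> a u v; rewrite innerDr innerZr.
pose f : {linear H1 -> R^o} :=
  HB.pack (inner g : H1 -> R^o) (GRing.isLinear.Build _ _ _ _ _ lin).
have fc : continuous f.
  apply/linear_bounded_continuous/linear_boundedP; exists `|g|.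
  split=> [|r gr z]; first by rewrite num_real.
  by apply: (le_trans (inner_le _ _)); rewrite ler_wpM2r// ltW.
have E : bregman psi ^~ xb = psi - ((f : H1 -> R^o) + cst (psi xb - f xb)).
  apply/funext => z; rewrite /bregman -/g -[inner g _]/(f (z - xb)) linearB !fctE.
  by rewrite -!addrA !opprD !opprK; congr (_ + _); rewrite addrCA.
have df : differentiable f x by exact: linear_differentiable.
have dfk : differentiable ((f : H1 -> R^o) + cst (psi xb - f xb)) x by exact: differentiableD.
apply: inner_inj => h; rewrite -gradientP; last by rewrite E; exact: differentiableB.
rewrite E diffB// diffD// diff_cst diff_lin// -scaleN1r.
rewrite innerDl innerZl -gradientP//. by rewrite mulN1r; congr (_ - _); exact: addr0.
Qed.

End AdjointGradient.

(* Main.v *)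
From HB Require Import structures.
Require Import Defs.
From mathcomp Require Import all_boot all_order all_algebra.
From mathcomp Require Import all_classical all_reals all_analysis.
From mathcomp Require Import lra.

(** Put h(x, y) = psi1 x + psi2 y - <C x, y>, let D be its Bregman divergence
    and M(x, y) = (A x + C^* y) * (B^-1 y - C x). The iteration is the Bregman
    proximal point method 0 in grad h(z_(n+1)) - grad h(z_n) + M z_(n+1). By
    the three-point identity and monotonicity of M, for every w in M z,
      <z_(n+1) - z, w> <= D(z, z_n) - D(z, z_(n+1)).
    For w = 0 and z a solution this bounds the iterates, since D is bounded
    below by a multiple of the squared distance. Averaging gives
    <Z_N - z, w> <= D(z, z_0) / N, hence <Z - z, w> <= 0 at a weak limit Z,
    and 0 in M Z by maximality of A and B. *)

Set Implicit Arguments.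
Unset Strict Implicit.
Unset Printing Implicit Defensive.

Import Order.TTheory GRing.Theory Num.Theory.
Import numFieldNormedType.Exports.

Local Open Scope classical_set_scope.
Local Open Scope ring_scope.

Section InnerProduct.
Context {R : realType} {H : hilbertType R}.
Implicit Types x y z : H.

Lemma innerNl x y : inner (- x) y = - inner x y.
Proof. by rewrite -scaleN1r innerZl mulN1r. Qed.

Lemma innerNr x y : inner x (- y) = - inner x y.
Proof. by rewrite innerC innerNl innerC. Qed.

Lemma inner0l y : inner (0 : H) y = 0.
Proof. by rewrite -(scale0r 0) innerZl mul0r. Qed.

Definition innerE :=
  (@innerDl R H, @innerDr R H, innerNl, innerNr, @innerZl R H, @innerZr R H).

Lemma inner_suml (I : Type) (r : seq I) (F : I -> H) y :
  inner (\sum_(i <- r) F i) y = \sum_(i <- r) inner (F i) y.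
Proof.
by elim: r => [|i r IH]; rewrite ?big_nil ?inner0l// !big_cons innerDl IH.
Qed.

(** Otherwise adjoining the single pair [(x, u)] to the graph of [M] would give a proper monotone
    extension. *)
Lemma maximally_monotoneP (M : H -> set H) x u :
  maximally_monotone M ->
  (forall x' u', M x' u' -> 0 <= inner (x' - x) (u' - u)) -> M x u.
Proof.
move=> [Mm Mmax] xu; apply: contrapT => nM; apply: Mmax.
exists (fun x' => M x' `|` [set u' | x' = x /\ u' = u]).
  move=> a b c d [Mac|[-> ->]] [Mbd|[-> ->]].
  - exact: Mm.
  - exact: xu.
  - by rewrite -(opprB b) -(opprB d) innerNl innerNr opprK xu.
  - by rewrite subrr inner0l.
split; first by move=> [a b] /= Mab; left.
by move=> /(_ (x, u)) /= h; apply/nM/h; right.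
Qed.

End InnerProduct.

Section PrimalDual.
Context {R : realType} {H1 H2 : hilbertType R}.
Implicit Types (A : H1 -> set H1) (B : H2 -> set H2) (C : {linear H1 -> H2}).

(* If the inclusion in A fails, maximality of A gives (u, a) with a negative
   first term, so the second term is positive for all (b, v) in B; maximality
   of B then makes (b, v) = (C X, Y) admissible, where that term vanishes. *)
Lemma pd_solution_of_variational A B C X Y :
  maximally_monotone A -> maximally_monotone B ->
  (forall u a v b, A u a -> B b v ->
     0 <= inner (u - X) (a + adjoint C Y) + inner (v - Y) (b - C X)) ->
  pd_solution A B C X Y.
Proof.
move=> Am Bm vi.
have AX : A X (- adjoint C Y).
  apply: contrapT => nA; apply: (nA).
  apply: maximally_monotoneP => // u a Aua; rewrite opprK.
  case: (lerP 0 (inner (u - X) (a + adjoint C Y))) => // neg.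
  have BY : B (C X) Y.
    apply: maximally_monotoneP => // b v Bbv; rewrite innerC.
    have := vi _ _ _ _ Aua Bbv; lra.
  by have := vi _ _ _ _ Aua BY; rewrite !subrr inner0l addr0 leNgt neg.
split=> //; apply: maximally_monotoneP => // b v Bbv; rewrite innerC.
by have := vi _ _ _ _ AX Bbv; rewrite subrr inner0l add0r.
Qed.

(** The Bregman divergence of [psi1 u + psi2 v - inner (C u) v]: the remainder of a bilinear term is
    that term evaluated at the increments. *)
Definition pd_bregman C (psi1 : H1 -> R^o) (psi2 : H2 -> R^o)
    (u ub : H1) (v vb : H2) : R :=
  bregman psi1 u ub + bregman psi2 v vb - inner (C (u - ub)) (v - vb).

Lemma bregman_three_point (H : hilbertType R) (psi : H -> R^o) (u v w : H) :
  bregman psi u w - bregman psi u v - bregman psi v w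
    = inner (gradient psi v - gradient psi w) (u - v) :> R.
Proof.
rewrite /bregman; move: (gradient psi v) (gradient psi w) => g h.
by move: (psi u : R) (psi v : R) (psi w : R) => a b c; rewrite !innerE; lra.
Qed.

Lemma ergodic_avgE (V : normedModType R) (x : nat -> V) N :
  ergodic_avg x N = N%:R^-1 *: \sum_(0 <= n < N) x n.+1.
Proof. by rewrite /ergodic_avg big_add1. Qed.

Lemma ergodic_avg_le (V : normedModType R) (x : nat -> V) (K : R) k :
  (forall n, `|x n.+1| <= K) -> `|ergodic_avg x k.+1| <= K.
Proof.
move=> xK; rewrite ergodic_avgE normrZ ger0_norm ?invr_ge0//.
rewrite ler_pdivrMl ?ltr0n//; apply: (le_trans (ler_norm_sum _ _ _)).
apply: (le_trans (ler_sum _ (fun n _ => xK n))).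
by rewrite sumr_const_nat subn0 mulr_natl.
Qed.

Lemma ergodic_avgB (V : normedModType R) (x : nat -> V) k u :
  ergodic_avg x k.+1 - u = k.+1%:R^-1 *: \sum_(0 <= n < k.+1) (x n.+1 - u).
Proof.
rewrite ergodic_avgE sumrB sumr_const_nat subn0 scalerBr -(scaler_nat k.+1 u).
by rewrite scalerA mulVf ?scale1r// pnatr_eq0.
Qed.

(** Pairing with [(p, q)] is an admissible test functional: for the max norm on the product it is
    bounded by [|p| + |q|]. *)
Lemma weak_cvg_inner (z : nat -> H1 * H2) X Y p q :
  weak_cvg z (X, Y) ->
  inner (z n).1 p + inner (z n).2 q @[n --> \oo] --> inner X p + inner Y q.
Proof.
have lin : linear (fun w : H1 * H2 => inner w.1 p + inner w.2 q : R^o).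
  move=> a [u1 u2] [v1 v2] /=; rewrite !innerE /GRing.scale /=; lra.
pose f : {linear (H1 * H2)%type -> R^o} :=
  HB.pack (fun w : H1 * H2 => inner w.1 p + inner w.2 q : R^o)
    (GRing.isLinear.Build _ _ _ _ _ lin).
have fc : continuous f.
  apply/linear_bounded_continuous/linear_boundedP; exists (`|p| + `|q|).
  split=> [|r gr w]; first by rewrite num_real.
  apply: (le_trans (ler_normD _ _)).
  apply: (le_trans (lerD (inner_le _ _) (inner_le _ _))).
  have w1 : `|w.1| <= `|w| by rewrite prod_normE le_max lexx.
  have w2 : `|w.2| <= `|w| by rewrite prod_normE le_max lexx orbT.
  apply: (@le_trans _ _ ((`|p| + `|q|) * `|w|)).
    by rewrite mulrDl !(mulrC _ `|w|) lerD// ler_wpM2r.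
  by rewrite ler_wpM2r// ltW.
by move=> /(_ f fc).
Qed.

Section Iterates.
Variables (A : H1 -> set H1) (B : H2 -> set H2) (C : {linear H1 -> H2}).
Variables (psi1 : H1 -> R^o) (psi2 : H2 -> R^o).
Variables (x xt : nat -> H1) (y : nat -> H2).
Hypotheses (Am : monotone_op A) (Bm : monotone_op B) (Cc : continuous C).
Hypotheses (d1 : forall u, differentiable psi1 u).
Hypotheses (d2 : forall v, differentiable psi2 v).
Hypothesis D_ge0 : forall u ub v vb, 0 <= pd_bregman C psi1 psi2 u ub v vb.
Hypothesis xyP : pdhg_iterates A B C psi1 psi2 x xt y.

Let D n u v := pd_bregman C psi1 psi2 u (x n) v (y n).

(** The slack is exactly the two monotonicity products plus the divergence of iterate [n.+1] from
    iterate [n]. The extrapolation [2 *: x n.+1 - x n] is what makes the terms in [C] match those of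
    the three divergences. *)
Lemma pdhg_step n u a v b : A u a -> B b v ->
  inner (x n.+1 - u) (a + adjoint C v) + inner (y n.+1 - v) (b - C u)
    <= D n u v - D n.+1 u v.
Proof.
move=> Aua Bbv.
have [[a' Aa' eqa] -> [b' Bb' eqb]] := xyP n.
have := Am Aa' Aua; have := Bm Bb' Bbv.
have -> : a' = - adjoint C (y n)
    - (gradient psi1 (x n.+1) - gradient psi1 (x n)).
  by rewrite -eqa gradient_bregman// addrC addKr.
have -> : b' = C (2 *: x n.+1 - x n)
    - (gradient psi2 (y n.+1) - gradient psi2 (y n)).
  by rewrite -eqb gradient_bregman// addrC addKr.
have := D_ge0 (x n.+1) (x n) (y n.+1) (y n).
rewrite /D /pd_bregman.
have tp1 := bregman_three_point psi1 u (x n.+1) (x n).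
have tp2 := bregman_three_point psi2 v (y n.+1) (y n).
move: tp1 tp2.
(* Once gradient differences and divergences are atoms and each adjoint is moved back to [C], the
   claim is linear in the divergences and inner products. *)
move: (gradient psi1 (x n.+1) - _) (gradient psi2 (y n.+1) - _) => g1 g2.
do 6![move: (bregman _ _ _ : R) => ?].
move: (x n) (x n.+1) (y n) (y n.+1) => p p' q q'.
have CB w w' : C (w - w') = C w - C w' by exact: linearB.
have CZ w k : C (k *: w) = k *: C w by exact: linearZ.
have CA := adjointP Cc.
move: (adjoint C) CA CB CZ; move: (C : H1 -> H2) => L Ls CA CB CZ.
rewrite !CB !CZ.
rewrite !innerE -!CA.
rewrite !(innerC b) !(innerC _ (L _)) !(innerC g1) !(innerC g2).
by move=> {CA CB CZ eqa eqb}; lra.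
Qed.

Lemma pdhg_ergodic_gap k u a v b : A u a -> B b v ->
  inner (ergodic_avg x k.+1 - u) (a + adjoint C v)
    + inner (ergodic_avg y k.+1 - v) (b - C u) <= D 0 u v / k.+1%:R.
Proof.
move=> Aua Bbv; rewrite !ergodic_avgB !innerZl -mulrDr mulrC.
rewrite ler_pM2r ?invr_gt0//.
rewrite !inner_suml -big_split /=.
apply: (le_trans (ler_sum _ (fun n _ => pdhg_step n Aua Bbv))).
(* The sum telescopes to [D 0 u v - D k.+1 u v], whose last term is dropped by nonnegativity. *)
under eq_bigr do rewrite -opprB; rewrite sumrN telescope_sumr// opprB.
by rewrite gerBl D_ge0.
Qed.

(** At a solution, [pdhg_step] applies with [a = - adjoint C ys] and [b = C xs], for which its left
    side vanishes. *)
Lemma pdhg_fejer n xs ys : pd_solution A B C xs ys -> D n xs ys <= D 0 xs ys.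
Proof.
move=> [As Bs]; elim: n => // n; apply: le_trans.
have := pdhg_step n As Bs.
by rewrite addNr subrr ![inner _ 0]innerC !inner0l addr0 subr_ge0.
Qed.

End Iterates.
End PrimalDual.

Theorem theorem1 (R : realType) (H1 H2 : hilbertType R)
    (A : H1 -> set H1) (B : H2 -> set H2) (C : {linear H1 -> H2})
    (psi1 : H1 -> R^o) (psi2 : H2 -> R^o)
    (x xt : nat -> H1) (y : nat -> H2) :
  maximally_monotone A -> maximally_monotone B ->
  (exists M : R, forall z, `|C z| <= M * `|z|) ->
  (exists z, C z <> 0) ->
  cont_frechet_diff psi1 -> convex_function setT psi1 ->
  cont_frechet_diff psi2 -> convex_function setT psi2 ->
  (exists2 alpha : R, 0 < alpha &
     forall (u ub : H1) (v vb : H2),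
       bregman psi1 u ub + bregman psi2 v vb - inner (C (u - ub)) (v - vb)
         >= alpha * (`|u - ub| ^+ 2 + `|v - vb| ^+ 2)) ->
  (exists xs ys, pd_solution A B C xs ys) ->
  pdhg_iterates A B C psi1 psi2 x xt y ->
  (* k indexes the average over the first N = k + 1 iterates *)
  let Z := fun k => (ergodic_avg x k.+1, ergodic_avg y k.+1) in
  bounded_fun Z /\
  (forall X Y, weak_subseq_limit Z (X, Y) -> pd_solution A B C X Y).
Proof.
move=> Am Bm [M CM] _ [d1 _] _ [d2 _] _ [al al0 Dal] [xs [ys sol]] xyP Z.
have Cc : continuous C.
  apply: bounded_linear_continuous; apply/linear_boundedP; exists M.
  split=> [|r Mr w]; first by rewrite num_real.
  by apply: (le_trans (CM w)); rewrite ler_wpM2r// ltW.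
have D_lb u ub v vb : al * (`|u - ub| ^+ 2 + `|v - vb| ^+ 2)
    <= pd_bregman C psi1 psi2 u ub v vb by exact: Dal.
have D_ge0 u ub v vb : 0 <= pd_bregman C psi1 psi2 u ub v vb.
  by apply: le_trans (D_lb _ _ _ _); rewrite mulr_ge0 ?addr_ge0 ?sqr_ge0 ?ltW.
have gap := pdhg_ergodic_gap Am.1 Bm.1 Cc d1 d2 D_ge0 xyP.
split.
  (* If [s ^+ 2 + t ^+ 2 <= c], then [s] and [t] are at most [c + 1], because [2 * s <= s ^+ 2 + 1];
     this avoids square roots. *)
  pose r := pd_bregman C psi1 psi2 xs (x 0) ys (y 0) / al + 1.
  have rP n : `|xs - x n| <= r /\ `|ys - y n| <= r.
    have := pdhg_fejer Am.1 Bm.1 Cc d1 d2 D_ge0 xyP n sol.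
    move/(le_trans (D_lb _ _ _ _)); rewrite mulrC -ler_pdivlMr// /r.
    move: (_ / al) `|xs - x n| `|ys - y n| => c s t.
    have := sqr_ge0 (s - 1); have := sqr_ge0 (t - 1).
    by have := sqr_ge0 s; have := sqr_ge0 t; split; lra.
  exists (`|xs| + `|ys| + r); split; first exact: num_real.
  move=> K rK k _ /=; apply: le_trans (ltW rK).
  have near_le (V : normedModType R) (w w' : V) : `|w'| <= `|w| + `|w - w'|.
    by have := ler_normB w (w - w'); rewrite opprB addrC subrK.
  rewrite prod_normE ge_max; apply/andP; split.
  - apply: ergodic_avg_le => n; apply: (le_trans (near_le _ xs _)).
    by rewrite -addrA lerD2l (le_trans (rP _).1)// lerDr.
  - apply: ergodic_avg_le => n; apply: (le_trans (near_le _ ys _)).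
    by rewrite (addrC `|xs|) -addrA lerD2l (le_trans (rP _).2)// lerDr.
move=> X Y [phi phi_incr Zphi].
apply: pd_solution_of_variational => // u a v b Aua Bbv.
(* By skew-symmetry of the coupling, [adjoint C (v - Y)] paired with [u - X] cancels [C (u - X)]
   paired with [v - Y]. Hence [Y] and [X] may be replaced by [v] and [u] in the second arguments,
   giving the vectors of the gap estimate. *)
have -> : inner (u - X) (a + adjoint C Y) + inner (v - Y) (b - C X)
    = (inner u (a + adjoint C v) + inner v (b - C u))
      - (inner X (a + adjoint C v) + inner Y (b - C u)).
  by rewrite !innerE -!(adjointP Cc) !(innerC _ (C _)); lra.
rewrite subr_ge0.
set w1 := a + _; set w2 := b - _.
pose d := pd_bregman C psi1 psi2 u (x 0) v (y 0).
(* Since [n <= phi n], the gap bound [d / (phi n).+1] is at most [d / n.+1], so it vanishes along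
   the subsequence. *)
have lim : inner u w1 + inner v w2 + d * n.+1%:R^-1 @[n --> \oo]
    --> inner u w1 + inner v w2.
  rewrite -[X in _ --> X]addr0; apply: cvgD; first exact: cvg_cst.
  by rewrite -(mulr0 d); apply: cvgM; [exact: cvg_cst|exact: cvg_harmonic].
have avg_lim := weak_cvg_inner (p := w1) (q := w2) Zphi.
have phi_ge n : (n <= phi n)%N.
  elim: n => // n IH; apply: (leq_ltn_trans IH).
  exact: (increasing_seqP phi).2 phi_incr n.
apply: (ler_cvg_to avg_lim lim); apply: nearW => n; rewrite /Z /=.
have dn : d / (phi n).+1%:R <= d * n.+1%:R^-1.
  by rewrite ler_wpM2l ?D_ge0// lef_pV2 ?posrE// ler_nat ltnS.
have := le_trans (gap (phi n) _ _ _ _ Aua Bbv) dn.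
by rewrite -/w1 -/w2 2!innerDl 2!innerNl addrACA -opprD lerBlDl.
Qed.
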